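(* Let $n\ge1$, $m\ge1$, $V=\mathbb{R}^{2n}$ with its standard symplectic form $\omega$, and let $G=\mathrm{Sp}(2n,\mathbb{R})$ act diagonally on $V^{\times m}$. Let $\mathcal{F}_G^m$ be the field of $G$-invariant real rational functions on $V^{\times m}$, and let $$\bar{\boldsymbol a}=\{a_{ij}:1\le i\le 2n,\ i<j\le m\}.$$ Then $\mathcal{F}_G^m=\mathbb{R}(\bar{\boldsymbol a})$, and the transcendence degree of $\mathcal{F}_G^m$ over $\mathbb{R}$ is $$d(m,n)=\begin{cases}2nm-n(2n+1)&\text{for } m\ge 2n,\\ \binom m2&\text{for } m\le 2n,\end{cases}$$ which equals the cardinality of $\bar{\boldsymbol a}$ (so the elements of $\bar{\boldsymbol a}$ are algebraically independent).
   Context: $V=\mathbb{R}^{2n}$ has coordinates $(x^1,\dots,x^n,y^1,\dots,y^n)$ and $\omega=dx^1\wedge dy^1+\dots+dx^n\wedge dy^n$. A point of $V^{\times m}$ is an $m$-tuple $(A_1,\dots,A_m)$, where $A_i$ has coordinates $(x_i^k,y_i^k)_{k=1}^n$. The functions $a_{ij}$ on $V^{\times m}$ are $a_{ij}=\omega(A_i,A_j)=\sum_{k=1}^n (x_i^k y_j^k-x_j^k y_i^k)$. *)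

(* Defs.v *)
From HB Require Import structures.
From mathcomp Require Import all_boot all_order all_algebra.
From mathcomp Require Import generic_quotient fraction finmap reals.
From mathcomp Require Import mpoly.

Set Implicit Arguments.
Unset Strict Implicit.
Unset Printing Implicit Defensive.

Import GRing.Theory.
Local Open Scope ring_scope.

(* Field extensions F -> K given by a map iota; subfields of K that need not
   be decidable are predicates E : K -> Prop. *)

(* F(S): the intersection of all subfields of K containing F and S.  In a field
   the inverse of 0 is 0, so that divring_closed means "is a subfield". *)
Definition generated_subfield (F K : fieldType) (iota : F -> K)
    (S : K -> Prop) (f : K) : Prop :=
  forall E : {pred K}, GRing.divring_closed E ->
    (forall c, iota c \in E) -> (forall s, S s -> s \in E) -> f \in E.

Definition algebraic_over_subfield (K : fieldType) (E : K -> Prop) (f : K) : Prop :=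
  exists p : {poly K}, [/\ p != 0, forall i, E p`_i & root p f].

Definition algebraically_independent (F K : fieldType) (iota : F -> K)
    (B : {fset K}) : Prop :=
  forall p : {mpoly F[#|` B|]},
    mmap iota (fun i : 'I_(#|` B|) => (enum_fset B)`_i) p = 0 -> p = 0.

Definition transcendence_basis (F K : fieldType) (iota : F -> K)
    (E : K -> Prop) (B : {fset K}) : Prop :=
  [/\ forall b, b \in B -> E b,
      algebraically_independent iota B
    & forall f, E f ->
        algebraic_over_subfield (generated_subfield iota (fun b => b \in B)) f].

(* E has (finite) transcendence degree d over F. *)
Definition has_trdeg (F K : fieldType) (iota : F -> K) (E : K -> Prop) (d : nat)
    : Prop :=
  exists B : {fset K}, transcendence_basis iota E B /\ #|` B| = d.

(* The coordinates (x^1, ..., x^n, y^1, ..., y^n) of a column vector v are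
   x^k = v (lshift n k) 0 and y^k = v (rshift n k) 0. *)
Definition omega (S : comNzRingType) (n : nat) (u v : 'cV[S]_(n + n)) : S :=
  \sum_(k < n) (u (lshift n k) 0 * v (rshift n k) 0
                - v (lshift n k) 0 * u (rshift n k) 0).

Definition symplectic (R : comNzRingType) (n : nat) (g : 'M[R]_(n + n)) : Prop :=
  forall u v : 'cV[R]_(n + n), omega (g *m u) (g *m v) = omega u v.

(* An m-tuple (A_1, ..., A_m) of vectors is the matrix with columns A_1, ..., A_m;
   its entries are numbered by mxvec_index. *)
Definition polyfun (R : realType) (n m : nat) : idomainType :=
  {mpoly R[(n + n) * m]}.

Definition ratfun (R : realType) (n m : nat) : fieldType :=
  {fraction (polyfun R n m)}.

Definition constfun (R : realType) (n m : nat) (c : R) : ratfun R n m :=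
  tofrac (c%:MP : polyfun R n m).

(* The matrix of coordinate functions on V^m. *)
Definition generic_point (R : realType) (n m : nat) : 'M[polyfun R n m]_(n + n, m) :=
  \matrix_(k, i) 'X_(mxvec_index k i).

(* The polynomial function (A_1, ..., A_m) |-> p (g A_1, ..., g A_m). *)
Definition poly_act (R : realType) (n m : nat) (g : 'M[R]_(n + n))
    (p : polyfun R n m) : polyfun R n m :=
  let gA : 'M[polyfun R n m]_(n + n, m) :=
    map_mx (@mpolyC _ R) g *m generic_point R n m in
  p \mPo [tuple mxvec gA 0 z | z < (n + n) * m].

(* Independent of the chosen fraction \n_/\d_ representing f when g is invertible. *)
Definition rat_act (R : realType) (n m : nat) (g : 'M[R]_(n + n))
    (f : ratfun R n m) : ratfun R n m :=
  tofrac (poly_act g \n_(repr f)) / tofrac (poly_act g \d_(repr f)).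

Definition Sp_invariant (R : realType) (n m : nat) (f : ratfun R n m) : Prop :=
  forall g : 'M[R]_(n + n), symplectic g -> rat_act g f = f.

Definition a_ (R : realType) (n m : nat) (i j : 'I_m) : ratfun R n m :=
  tofrac (omega (col i (generic_point R n m)) (col j (generic_point R n m))).

(* With indices starting from 0, the condition i <= 2n becomes i < 2n. *)
Definition abar (R : realType) (n m : nat) : {fset (ratfun R n m)} :=
  [fset a_ R n ij.1 ij.2
    | ij in [set ij : 'I_m * 'I_m | (ij.1 < 2 * n)%N && (ij.1 < ij.2)%N]]%fset.

Definition d_ (m n : nat) : nat :=
  if (2 * n <= m)%N then (2 * n * m - n * (2 * n + 1))%N else 'C(m, 2).

(* The two cases overlap at m = 2n, where they agree. *)
Lemma d_le (m n : nat) : (m <= 2 * n)%N -> d_ m n = 'C(m, 2).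
Proof.
rewrite /d_ => lem2n; case: ifP => // le2nm.
have -> : m = (2 * n)%N by apply: anti_leq; rewrite lem2n.
have -> : 'C(2 * n, 2) = (n * (2 * n).-1)%N.
  by rewrite bin2 -mulnA (mul2n (n * _)) doubleK.
rewrite mulnAC [X in (_ - X)%N]mulnC -mulnBl [RHS]mulnC; congr (_ * n)%N.
by rewrite {1}mul2n -addnn addn1 subnS addnK.
Qed.

(* Main.v *)
From HB Require Import structures.
Require Import Defs.
From mathcomp Require Import all_boot all_order all_algebra.
From mathcomp Require Import boolp fraction finmap reals mpoly.

(* Let F = R(V^m), let A be the matrix over F whose columns are the generic
   vectors A_1, ..., A_m, and let E be a subfield of F containing R and abar.
   Over F there is a symplectic g with g A defined over E: complete A (if
   m < 2n), or take its first 2n columns (if m >= 2n), to get an invertible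
   matrix whose Gram matrix is over E, and find a symplectic basis of that Gram
   matrix over E.
   An invariant f = p / q satisfies p(gA) q(A) = p(A) q(gA) for real symplectic
   g, hence also for symplectic g over F, by specialization at real points.
   Hence f = p(gA) / q(gA) lies in E, provided that q(gA) <> 0, which a real
   symplectic translation of g achieves.
   Independence: over the field of rational functions in variables c_ij, a
   symplectic basis of the generic alternating form provides vectors B_i with
   omega(B_i, B_j) = c_ij for i <= 2n, i < j, and A |-> B maps a_ij to c_ij. *)

Set Implicit Arguments.
Unset Strict Implicit.
Unset Printing Implicit Defensive.

Import GRing.Theory.
Local Open Scope ring_scope.

(** * Alternating forms over a subfield *)

Section MatricesOverSubring.
Variables (K : fieldType) (E : divringClosed K).

Lemma mxOver_mulmx m n p (A : 'M[K]_(m, n)) (B : 'M[K]_(n, p)) :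
  A \is a mxOver E -> B \is a mxOver E -> A *m B \is a mxOver E.
Proof.
move=> /mxOverP EA /mxOverP EB; apply/mxOverP=> i j.
by rewrite mxE rpred_sum // => k _; rewrite rpredM.
Qed.

Lemma mxOver_trmx m n (A : 'M[K]_(m, n)) : A \is a mxOver E -> A^T \is a mxOver E.
Proof. by move=> /mxOverP EA; apply/mxOverP=> i j; rewrite mxE. Qed.

Lemma mxOver_scale m n (c : K) (A : 'M[K]_(m, n)) :
  c \in E -> A \is a mxOver E -> c *: A \is a mxOver E.
Proof. by move=> Ec /mxOverP EA; apply/mxOverP=> i j; rewrite mxE rpredM. Qed.

Lemma mxOver_delta m n i j : delta_mx i j \is a @mxOver m n _ E.
Proof. by apply/mxOverP=> k l; rewrite mxE rpred_nat. Qed.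

Lemma mxOver_1 n : 1%:M \is a @mxOver n n _ E.
Proof. by apply/mxOverP=> k l; rewrite mxE rpredMn ?rpred1. Qed.

Lemma mxOver_col_mx m1 m2 n (A : 'M[K]_(m1, n)) (B : 'M[K]_(m2, n)) :
  A \is a mxOver E -> B \is a mxOver E -> col_mx A B \is a mxOver E.
Proof.
move=> /mxOverP EA /mxOverP EB; apply/mxOverP=> i j; rewrite mxE.
by case: split.
Qed.

Lemma mxOver_row_mx m n1 n2 (A : 'M[K]_(m, n1)) (B : 'M[K]_(m, n2)) :
  A \is a mxOver E -> B \is a mxOver E -> row_mx A B \is a mxOver E.
Proof.
move=> /mxOverP EA /mxOverP EB; apply/mxOverP=> i j; rewrite mxE.
by case: split.
Qed.

End MatricesOverSubring.

Section AlternatingForms.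
Variable K : fieldType.

Lemma gram_col_mx d p q p' q' (M : 'M[K]_d) (A : 'M_(p, d)) (B : 'M_(q, d))
    (C : 'M_(p', d)) (D : 'M_(q', d)) :
  col_mx A B *m M *m (col_mx C D)^T
    = block_mx (A *m M *m C^T) (A *m M *m D^T) (B *m M *m C^T) (B *m M *m D^T).
Proof. by rewrite tr_col_mx mul_col_mx mul_col_row. Qed.

Definition alternating d (M : 'M[K]_d) := forall v : 'rV_d, v *m M *m v^T = 0.

Lemma alternating_congr d e (Q : 'M[K]_(e, d)) (M : 'M_d) :
  alternating M -> alternating (Q *m M *m Q^T).
Proof. by move=> altM v; rewrite !mulmxA -(mulmxA _ Q^T) -trmx_mul altM. Qed.

Lemma alternating_tr d (M : 'M[K]_d) : alternating M -> M^T = - M.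
Proof.
move=> altM; apply/matrixP=> i j; rewrite !mxE.
have MdE (k l : 'I_d) :
    ((delta_mx 0 k : 'rV_d) *m M *m (delta_mx 0 l : 'rV_d)^T) 0 0 = M k l.
  by rewrite -rowE trmx_delta -colE !mxE.
(* Polarization at a sum of two basis vectors. *)
have := altM ((delta_mx 0 i) + (delta_mx 0 j)).
rewrite linearD /= mulmxDl mulmxDl !mulmxDr !altM addr0 add0r => /matrixP/(_ 0 0).
rewrite mxE (MdE i j) (MdE j i) mxE => /eqP.
by rewrite addr_eq0 => /eqP ->; rewrite opprK.
Qed.

(** [v *m C *m v^T] is a 1 by 1 matrix, hence equal to its transpose [v *m C^T *m v^T]. *)
Lemma alternating_subtr d (C : 'M[K]_d) : alternating (C - C^T).
Proof.
have tr11 (x : 'M[K]_1) : x^T = x by rewrite [x]mx11_scalar tr_scalar_mx.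
by move=> v; rewrite mulmxBr mulmxBl -[X in _ - X]tr11 !trmx_mul !trmxK mulmxA subrr.
Qed.

Lemma alternatingC d (M : 'M[K]_d) (altM : alternating M) p q
  (u : 'M_(p, d)) (v : 'M_(q, d)) : u *m M *m v^T = - (v *m M *m u^T)^T.
Proof.
by rewrite !trmx_mul trmxK (alternating_tr altM) mulNmx mulmxN opprK mulmxA.
Qed.

Variable E : divringClosed K.

(* If the Gram matrix G of X is singular, solve X J v^T = c for some c outside
   the column space of G; otherwise take v <> 0 orthogonal to X. *)
Lemma gram_extend_row d (J : 'M[K]_d) r (X : 'M_(r, d)) :
    row_free X -> J \in unitmx -> (r < d)%N ->
  exists v : 'rV_d, ~~ (v <= X)%MS /\ v *m (X *m J)^T \is a mxOver E.
Proof.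
move=> Xfree Junit ltrd; pose Y := (X *m J)^T.
have rkY : \rank Y = r by rewrite mxrank_tr mxrankMfree ?row_free_unit //; apply/eqP.
pose G := X *m Y.
case: (boolP (1%:M <= G)%MS) => [G1 | /row_subPn[i nGi]].
  have kerY : (kermx Y != 0) by rewrite -mxrank_eq0 mxrank_ker rkY subn_eq0 -ltnNge.
  have /sub_kermxP vY := nz_row_sub (kermx Y).
  exists (nz_row (kermx Y)); split; last by rewrite vY mxOver0 ?rpred0.
  apply/negP=> /submxP[w vE].
  have Gfree : row_free G by rewrite row_free_unit -row_full_unit -sub1mx.
  have w0 : w = 0.
    by apply: (row_free_inj Gfree); rewrite mul0mx /G mulmxA -vE vY.
  by move: kerY; rewrite -nz_row_eq0 vE w0 mul0mx eqxx.
exists (row i 1%:M *m pinvmx Y); rewrite -/Y mulmxKpV; last first.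
  by rewrite submx_full // /row_full rkY.
split; last by rewrite row1 mxOver_delta.
apply: contraNN nGi => /submxP[w wE].
rewrite -[row i _](@mulmxKpV _ _ _ _ _ Y); last by rewrite submx_full // /row_full rkY.
by rewrite wE -mulmxA submxMl.
Qed.

(** Induction on the number [k] of missing rows. A row from [gram_extend_row] pairs with [X] over
    [E], pairs to 0 with itself, and antisymmetry gives the remaining block. [Q] expresses [X] in
    the completed frame, so that pairings with [X] can be computed over [E]. *)
Lemma gram_extend_unit d (J : 'M[K]_d) (altJ : alternating J)
    (Junit : J \in unitmx) k : forall r (X : 'M_(r, d)),
    (r + k)%N = d -> row_free X -> X *m J *m X^T \is a mxOver E ->
  exists X0 : 'M_d, exists Q : 'M_(r, d),
    [/\ X0 \in unitmx, X0 *m J *m X0^T \is a mxOver E,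
        Q \is a mxOver E & X = Q *m X0].
Proof.
elim: k => [|k IHk] r X; rewrite ?addn0.
  move=> eq_rd Xfree EX; subst d; exists X, 1%:M.
  by rewrite -row_free_unit mul1mx mxOver_1.
move=> eq_rd Xfree EX.
have ltrd : (r < d)%N by rewrite -eq_rd addnS ltnS leq_addr.
have [v [vX Ev]] := gram_extend_row Xfree Junit ltrd.
have Ev' : v *m J *m X^T \is a mxOver E.
  move: Ev; rewrite trmx_mul (alternating_tr altJ) mulNmx mulmxN rpredN.
  by rewrite mulmxA.
have [|||X0 [Q [X0unit EX0 EQ XE]]] := IHk _ (col_mx X v).
- by rewrite -eq_rd addn1 addSnnS.
- have ltX : (X < X + v)%MS.
    by rewrite ltmxE addsmxSl; apply: contraNN vX => /(submx_trans (addsmxSr _ _)).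
  rewrite /row_free eqn_leq rank_leq_row -(addsmxE X v) /= {1}addn1.
  by move: (rank_ltmx ltX); rewrite (eqP Xfree).
- rewrite gram_col_mx block_mxEv altJ.
  rewrite mxOver_col_mx // mxOver_row_mx ?mxOver0 ?rpred0 //.
  by rewrite alternatingC // rpredN mxOver_trmx.
exists X0, (row_mx 1%:M 0 *m Q); split=> //.
  by rewrite mxOver_mulmx // mxOver_row_mx ?mxOver_1 ?mxOver0 ?rpred0.
by rewrite -mulmxA -XE mul_row_col mul1mx mul0mx addr0.
Qed.

(** Symplectic Gram-Schmidt: split off a hyperbolic pair [u], [w] and continue on its orthogonal
    complement, where the form loses rank at most 2. Only field operations occur, so all stays over
    [E]. *)
Lemma symplectic_basis n : forall d (M : 'M[K]_d),
    alternating M -> M \is a mxOver E -> (n + n <= \rank M)%N ->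
  exists U W : 'M_(n, d),
    [/\ U \is a mxOver E, W \is a mxOver E, U *m M *m U^T = 0,
        W *m M *m W^T = 0 & U *m M *m W^T = 1%:M].
Proof.
elim: n => [|n IHn] d M altM EM rkM.
  by exists 0, 0; rewrite !mxOver0 ?rpred0 // !mul0mx; split=> //; apply/matrixP=> -[].
have /matrix0Pn[i [j nzMij]] : M != 0.
  by rewrite -mxrank_eq0 -lt0n (leq_trans _ rkM).
pose u : 'rV[K]_d := (delta_mx 0 i); pose w : 'rV[K]_d := (M i j)^-1 *: (delta_mx 0 j).
have Eu : u \is a mxOver E by exact: mxOver_delta.
have Ew : w \is a mxOver E.
  by rewrite mxOver_scale ?mxOver_delta // rpredV (mxOverP EM).
have uw : u *m M *m w^T = 1%:M.
  rewrite linearZ -scalemxAr -rowE /= trmx_delta -colE [col _ _]mx11_scalar !mxE.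
  by rewrite scale_scalar_mx mulVf.
have wu : w *m M *m u^T = - 1%:M by rewrite alternatingC // uw tr_scalar_mx.
(* [v *m Q] is [v] minus its components along [u] and [w]: the projection onto their orthogonal
   complement for [M]. *)
pose Q := 1%:M - M *m w^T *m u + M *m u^T *m w.
have EQ : Q \is a mxOver E.
  by rewrite rpredD ?rpredB ?mxOver_1 // !mxOver_mulmx ?mxOver_trmx.
have Qu : Q *m M *m u^T = 0.
  rewrite /Q !mulmxDl !mulNmx mul1mx -!mulmxA !(mulmxA w) wu (mulmxA u) altM.
  by rewrite !mulmx0 subr0 !mulmxN !mulmx1 subrr.
have Qw : Q *m M *m w^T = 0.
  rewrite /Q !mulmxDl !mulNmx mul1mx -!mulmxA !(mulmxA w) altM (mulmxA u) uw.
  by rewrite !mulmx0 addr0 !mulmx1 subrr.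
have QMQ : Q *m M *m Q^T = Q *m M.
  rewrite /Q linearD linearB /= trmx1 -/Q !trmx_mul mulmxDr mulmxBr mulmx1.
  by rewrite !mulmxA Qu Qw !mul0mx addr0 subr0.
have [|||U [W [EU EW UU WW UW]]] := IHn _ (Q *m M *m Q^T).
- exact: alternating_congr.
- by rewrite !mxOver_mulmx ?mxOver_trmx.
- rewrite QMQ.
  (* [Q *m M] differs from [M] by two matrices of rank at most 1. *)
  have -> : Q *m M = M - M *m w^T *m (u *m M) + M *m u^T *m (w *m M).
    by rewrite /Q !mulmxDl mulNmx mul1mx !mulmxA.
  set B1 := _ *m (u *m M); set B2 := _ *m (w *m M).
  have rk1 : (\rank B1 <= 1)%N by rewrite (leq_trans (mxrankM_maxr _ _)) ?rank_leq_row.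
  have rk2 : (\rank B2 <= 1)%N by rewrite (leq_trans (mxrankM_maxr _ _)) ?rank_leq_row.
  have : (\rank M <= \rank (M - B1 + B2)%R + 1 + 1)%N.
    have {1}-> : M = M - B1 + B2 + B1 - B2 by rewrite addrAC addrK subrK.
    rewrite (leq_trans (mxrank_add _ _)) // leq_add ?mxrank_opp //.
    by rewrite (leq_trans (mxrank_add _ _)) // leq_add2l.
  move/(leq_trans rkM); by rewrite addSn addnS !addn1 !ltnS.
(* [Q] carries the basis of the projected form into the orthogonal complement of [u] and [w]. *)
exists (col_mx u (U *m Q)), (col_mx w (W *m Q)).
have QE (A B : 'M_(n, d)) : A *m Q *m M *m (B *m Q)^T = A *m (Q *m M *m Q^T) *m B^T.
  by rewrite trmx_mul !mulmxA.
have Qu' (A : 'M_(n, d)) : u *m M *m (A *m Q)^T = 0.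
  by rewrite alternatingC // -!mulmxA (mulmxA Q) Qu mulmx0 trmx0 oppr0.
have Qw' (A : 'M_(n, d)) : w *m M *m (A *m Q)^T = 0.
  by rewrite alternatingC // -!mulmxA (mulmxA Q) Qw mulmx0 trmx0 oppr0.
have Qu2 (A : 'M_(n, d)) : A *m Q *m M *m u^T = 0.
  by rewrite -!mulmxA (mulmxA Q) Qu mulmx0.
have Qw2 (A : 'M_(n, d)) : A *m Q *m M *m w^T = 0.
  by rewrite -!mulmxA (mulmxA Q) Qw mulmx0.
split; try by apply: (@mxOver_col_mx _ E 1); rewrite ?mxOver_mulmx.
- apply: etrans (gram_col_mx M u (U *m Q) u (U *m Q)) _.
  by rewrite QE UU altM Qu' Qu2 block_mx0.
- apply: etrans (gram_col_mx M w (W *m Q) w (W *m Q)) _.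
  by rewrite QE WW altM Qw' Qw2 block_mx0.
apply: etrans (gram_col_mx M u (U *m Q) w (W *m Q)) _.
by rewrite QE UW uw Qu' Qw2 -scalar_mx_block.
Qed.

End AlternatingForms.

(** * The symplectic group and its slices *)

Section StandardForm.
Variables (S : comNzRingType) (n : nat).

Definition sympJ : 'M[S]_(n + n) := block_mx 0 1%:M (- 1%:M) 0.

Lemma omegaE (u v : 'cV[S]_(n + n)) : omega u v = (u^T *m sympJ *m v) 0 0.
Proof.
rewrite -{2}[u]vsubmxK -{2}[v]vsubmxK tr_col_mx mul_row_block mul_row_col.
rewrite !mulmx0 !mulmx1 mulmxN mulmx1 addr0 add0r mulNmx !mxE -sumrN -big_split /=.
rewrite /omega; apply: eq_bigr => k _; rewrite !mxE addrC.
by rewrite [v _ _ * _]mulrC.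
Qed.

Lemma omega_col p q (A : 'M[S]_(n + n, p)) (B : 'M[S]_(n + n, q)) i j :
  omega (col i A) (col j B) = (A^T *m sympJ *m B) i j.
Proof. by rewrite omegaE tr_col -row_mul colE mulmxA -row_mul -colE !mxE. Qed.

Lemma trmx_sympJ : sympJ^T = - sympJ.
Proof. by rewrite tr_block_mx opp_block_mx linearN /= trmx1 !trmx0 oppr0 opprK. Qed.

Lemma sympJK : sympJ *m sympJ = - 1%:M.
Proof.
rewrite mulmx_block !mul0mx !mulmx0 mulNmx !mulmx1 mulmxN mulmx1 addr0 add0r.
by rewrite !addr0 scalar_mx_block opp_block_mx oppr0.
Qed.

Lemma symplecticP (g : 'M[S]_(n + n)) :
  symplectic g <-> g^T *m sympJ *m g = sympJ.
Proof.
split=> [sg | gJ u v]; last first.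
  by rewrite [RHS]omegaE -gJ omegaE trmx_mul !mulmxA.
have colg k : col k g = g *m col k 1%:M by rewrite !colE mul1mx.
by apply/matrixP=> i j; rewrite -omega_col !colg sg omega_col trmx1 mul1mx mulmx1.
Qed.

(** The inverse is J^-1 g^T J, where J^-1 = -J. *)
Lemma symplectic_inv (g : 'M[S]_(n + n)) :
  g^T *m sympJ *m g = sympJ -> exists h : 'M[S]_(n + n),
  [/\ h *m g = 1%:M, g *m h = 1%:M & h^T *m sympJ *m h = sympJ].
Proof.
move=> gJ; pose h := - (sympJ *m g^T *m sympJ).
have hg : h *m g = 1%:M.
  by rewrite mulNmx -!mulmxA (mulmxA g^T) gJ sympJK opprK.
have gh := mulmx1C hg.
exists h; split=> //.
rewrite -{1}gJ !mulmxA -trmx_mul gh trmx1 mul1mx.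
by rewrite -mulmxA gh mulmx1.
Qed.

(** -J g J is a left inverse of g^T, hence also a right inverse; multiply by J on the right. *)
Lemma symplectic_tr (g : 'M[S]_(n + n)) :
  g *m sympJ *m g^T = sympJ -> g^T *m sympJ *m g = sympJ.
Proof.
move=> gJ; have /mulmx1C : - (sympJ *m g *m sympJ) *m g^T = 1%:M.
  by rewrite mulNmx -!mulmxA (mulmxA g) gJ sympJK opprK.
rewrite mulmxN !mulmxA => /(congr1 (mulmx^~ sympJ)) /=.
by rewrite mulNmx -[X in - X]mulmxA sympJK mulmxN mulmx1 opprK mul1mx.
Qed.

End StandardForm.

Lemma map_sympJ (S T : comNzRingType) (phi : {rmorphism S -> T}) n :
  map_mx phi (sympJ S n) = sympJ T n.
Proof. by rewrite map_block_mx map_mxN !map_mx1 !map_mx0. Qed.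

Section Slice.
Variables (K : fieldType) (n : nat).
Local Notation J := (sympJ K n).

Lemma alternating_sympJ : alternating J.
Proof.
move=> v; rewrite [LHS]mx11_scalar -{1}[v]trmxK -omegaE /omega.
by rewrite big1 ?raddf0 // => k _; rewrite subrr.
Qed.

Lemma sympJ_unit : J \in unitmx.
Proof.
have : J *m (- J) = 1%:M by rewrite mulmxN sympJK opprK.
by case/mulmx1_unit.
Qed.

Variable E : divringClosed K.

Lemma sympJ_over : J \is a mxOver E.
Proof.
by apply: mxOver_col_mx; apply: mxOver_row_mx;
  rewrite ?rpredN ?mxOver_1 ?mxOver0 ?rpred0.
Qed.

Lemma standardize_gram (M : 'M[K]_(n + n)) :
    alternating M -> M \in unitmx -> M \is a mxOver E ->
  exists2 P : 'M_(n + n), P \is a mxOver E & P *m M *m P^T = J.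
Proof.
move=> altM Munit EM.
have [|U [W [EU EW UU WW UW]]] := symplectic_basis (n := n) altM EM.
  by rewrite mxrank_unit.
exists (col_mx U W); first exact: mxOver_col_mx.
by rewrite gram_col_mx UU WW UW (alternatingC altM W) UW tr_scalar_mx.
Qed.

(** If P over [E] brings the Gram matrix of the frame [X0] to standard form, then S = P X0 is
    symplectic. So is g = J S J, and g A = J P (X0 J A) is over [E]. *)
Lemma symplectic_slice_frame m (A : 'M[K]_(n + n, m)) (X0 : 'M_(n + n)) :
    X0 \in unitmx -> X0 *m J *m X0^T \is a mxOver E ->
    X0 *m J *m A \is a mxOver E ->
  exists2 g : 'M[K]_(n + n), g^T *m J *m g = J & g *m A \is a mxOver E.
Proof.
move=> X0unit EX0 EXA.
have Munit : X0 *m J *m X0^T \in unitmx.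
  by rewrite !unitmx_mul X0unit sympJ_unit unitmx_tr.
have [P EP PE] := standardize_gram (alternating_congr X0 alternating_sympJ) Munit EX0.
have SJ : P *m X0 *m J *m (P *m X0)^T = J by rewrite -[RHS]PE trmx_mul !mulmxA.
exists (J *m (P *m X0) *m J); last first.
  by rewrite -!mulmxA mxOver_mulmx ?sympJ_over // mxOver_mulmx // mulmxA.
have gT : (J *m (P *m X0) *m J)^T = J *m (P *m X0)^T *m J.
  by rewrite 2!trmx_mul trmx_sympJ mulNmx mulmxN mulmxN opprK mulmxA.
move: (symplectic_tr SJ); rewrite {}gT; move: (P *m X0) => S SJ'.
rewrite -(mulmxA (J *m S^T) J J) sympJK mulmxN mulmx1 mulNmx !mulmxA.
rewrite -(mulmxA J S^T J) -(mulmxA J _ S) SJ' sympJK mulNmx mul1mx opprK //.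
Qed.

(** The columns of [A] are completed to a frame [X0]. From A^T = Q X0 follows X0 J A = (X0 J X0^T)
    Q^T. *)
Lemma symplectic_slice_small m (A : 'M[K]_(n + n, m)) :
    (m <= n + n)%N -> \rank A = m -> A^T *m J *m A \is a mxOver E ->
  exists2 g : 'M[K]_(n + n), g^T *m J *m g = J & g *m A \is a mxOver E.
Proof.
move=> lem rkA EA.
have [|||X0 [Q [X0unit EX0 EQ AE]]] :=
  @gram_extend_unit _ E _ _ alternating_sympJ sympJ_unit (n + n - m) _ A^T.
- exact: subnKC.
- by rewrite /row_free mxrank_tr rkA.
- by rewrite trmxK.
apply: (symplectic_slice_frame X0unit EX0).
by rewrite -[A]trmxK AE trmx_mul mulmxA mxOver_mulmx ?mxOver_trmx.
Qed.

(** The selected 2n columns of [A] are themselves the frame; its Gram matrix is part of its pairings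
    with all columns. *)
Lemma symplectic_slice_large m (A : 'M[K]_(n + n, m)) (f : 'I_(n + n) -> 'I_m) :
    colsub f A \in unitmx ->
    (forall i j, (A^T *m J *m A) (f i) j \in E) ->
  exists2 g : 'M[K]_(n + n), g^T *m J *m g = J & g *m A \is a mxOver E.
Proof.
move=> fA EA.
have EfA : (colsub f A)^T *m J *m A \is a mxOver E.
  have -> : (colsub f A)^T *m J *m A = rowsub f (A^T *m J *m A).
    by rewrite trmx_mxsub -!mul_rowsub_mx.
  by apply/mxOverP=> i j; rewrite mxE.
apply: (@symplectic_slice_frame _ _ (colsub f A)^T) => //; rewrite ?unitmx_tr //.
rewrite trmxK mulmx_colsub.
by apply/mxOverP=> i j; rewrite mxE (mxOverP EfA).
Qed.

End Slice.

(** * Values of rational functions at real points *)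

Section VanishingPolynomials.
Variable R : realType.

Lemma meval_muni k (p : {mpoly R[k.+1]}) (v : 'I_k -> R) (t : R) :
  (map_poly (meval v) (muni p)).[t]
    = p.@[fun i => if unlift ord_max i is Some j then v j else t].
Proof.
set w := fun i => _; rewrite muniE mevalE raddf_sum horner_sum.
apply: eq_bigr => s _; rewrite /= map_polyZ /= hornerZ mevalZ map_polyXn hornerXn.
rewrite big_ord_recr /= mevalX -mulrA; congr (_ * (_ * _ ^+ _)); last first.
  by rewrite /w unlift_none.
apply: eq_bigr => i _; rewrite mnmE /w.
have -> : widen_ord (leqnSn k) i = lift ord_max i.
  by apply: val_inj; rewrite /= /bump leqNgt ltn_ord.
by rewrite liftK.
Qed.

(** A monomial is determined by its last exponent and its other exponents, so each coefficient of
    [p] is a coefficient of a coefficient of [muni p]. *)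
Lemma muni_eq0 k (p : {mpoly R[k.+1]}) : muni p = 0 -> p = 0.
Proof.
move=> p0; apply/mpolyP=> s; rewrite mcoeff0.
have := congr1 (fun q : {poly {mpoly R[k]}} =>
  (q`_(s ord_max))@_[multinom (s (widen_ord (leqnSn k) i)) | i < k]) p0.
rewrite muniE coef0 mcoeff0 coef_sum raddf_sum /=.
have [sp|] := boolP (s \in msupp p); last by move=> /memN_msupp_eq0.
rewrite (bigD1_seq s) ?msupp_uniq //= big1 ?addr0 => [|u us].
  by rewrite coefZ coefXn eqxx mulr1 mcoeffZ mcoeffX eqxx mulr1.
rewrite coefZ coefXn; case: eqP => [eq_s|]; last by rewrite mulr0 mcoeff0.
rewrite mulr1 mcoeffZ mcoeffX; case: eqP => [eq_u|]; last by rewrite mulr0.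
case/eqP: us; apply/mnmP=> i.
case: (unliftP ord_max i) => [j ->|-> //].
have := congr1 (fun r : 'X_{1..k} => r j) eq_u; rewrite !mnmE.
suff -> : widen_ord (leqnSn k) j = lift ord_max j by [].
by apply: val_inj; rewrite /= /bump leqNgt ltn_ord.
Qed.

(** Induction on the number of variables: with the others fixed, the polynomial in the last variable
    has too many roots, so all its coefficients vanish at every point. *)
Lemma mpoly_vanishing k (p : {mpoly R[k]}) : (forall v, p.@[v] = 0) -> p = 0.
Proof.
elim: k p => [|k IHk] p p0.
  apply/mpolyP=> s; rewrite mcoeff0 -(p0 (fun=> 0)) mevalE.
  have E0 (u : 'X_{1..0}) : u = s by apply/mnmP=> -[].
  have [sp|sp] := boolP (s \in msupp p).
    rewrite (bigD1_seq s) ?msupp_uniq //= big_ord0 mulr1 big1 ?addr0 // => u.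
    by rewrite (E0 u) eqxx.
  rewrite (memN_msupp_eq0 sp) big_seq big1 // => u.
  by rewrite (E0 u) (negbTE sp).
apply: muni_eq0; apply/polyP=> i; rewrite coef0; apply: IHk => v.
rewrite -coef_map /=; set q := map_poly _ _.
suff -> : q = 0 by rewrite coef0.
(* The natural numbers below [size q] are distinct roots, one more than the degree allows. *)
apply: (@roots_geq_poly_eq0 _ _ [seq j%:R | j <- iota 0 (size q)]).
- by apply/allP=> t _; rewrite /root meval_muni p0.
- rewrite map_inj_uniq ?iota_uniq // => a b /eqP; rewrite Num.Theory.eqr_nat.
  by move/eqP.
- by rewrite size_map size_iota.
Qed.

End VanishingPolynomials.

Lemma frac_numden (A : idomainType) (r : {fraction A}) :
  r = FracField.tofrac \n_(repr r) / FracField.tofrac \d_(repr r).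
Proof.
have nz : FracField.tofrac \d_(repr r) != 0 by rewrite tofrac_eq0 denom_ratioP.
apply: (mulIf nz); rewrite divfK // -{1}(reprK r); unlock FracField.tofrac.
rewrite -[LHS]FracField.pi_mul; apply/eqmodP.
by rewrite /= FracField.equivfE /FracField.mulf /= !numden_Ratio
  ?(oner_neq0, mulr1, denom_ratioP) // [eqbRHS]mulrC.
Qed.

Section Values.
Variables (R : realType) (k : nat).
Local Notation P := {mpoly R[k]}.
Local Notation F := {fraction P}.
Local Notation tofrac := (@FracField.tofrac P).
Local Notation cst := (tofrac \o @mpolyC k R).

(** A relation rather than a function: [r] may be undefined at [x], and the denominator picked by
    [repr] may vanish at [x] while that of another fraction for [r] does not. *)
Definition has_value (x : 'I_k -> R) (r : F) (v : R) :=
  exists a b : P, [/\ b.@[x] != 0, r = tofrac a / tofrac b & v = a.@[x] / b.@[x]].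

Lemma tofrac_neq0 (b : P) x : b.@[x] != 0 -> tofrac b != 0.
Proof. by rewrite tofrac_eq0; apply: contraNneq => ->; rewrite meval0. Qed.

Lemma has_value_uniq x r v w : has_value x r v -> has_value x r w -> v = w.
Proof.
move=> [a [b [b0 -> ->]]] [c [d [d0 eq_r ->]]].
apply/eqP; rewrite eqr_div //; move/eqP: eq_r.
rewrite eqr_div ?(tofrac_neq0 (x := x)) // -!tofracM tofrac_eq => /eqP eq_ad.
by rewrite -!mevalM eq_ad.
Qed.

Lemma has_value_tofrac x p : has_value x (tofrac p) p.@[x].
Proof.
by exists p, 1; rewrite meval1 oner_neq0 tofrac1 !divr1.
Qed.

Lemma has_value_cst x c : has_value x (cst c) c.
Proof. by have := has_value_tofrac x c%:MP; rewrite mevalC. Qed.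

Lemma has_value0 x : has_value x 0 0.
Proof. by rewrite -tofrac0 -(meval0 x); apply: has_value_tofrac. Qed.

Lemma has_valueD x r s v w :
  has_value x r v -> has_value x s w -> has_value x (r + s) (v + w).
Proof.
move=> [a [b [b0 -> ->]]] [c [d [d0 -> ->]]]; exists (a * d + c * b), (b * d).
split; first by rewrite mevalM mulf_neq0.
  by rewrite addf_div ?(tofrac_neq0 (x := x)) // tofracD !tofracM.
by rewrite addf_div // mevalD !mevalM.
Qed.

Lemma has_valueM x r s v w :
  has_value x r v -> has_value x s w -> has_value x (r * s) (v * w).
Proof.
move=> [a [b [b0 -> ->]]] [c [d [d0 -> ->]]]; exists (a * c), (b * d).
by rewrite !mulf_div !mevalM !tofracM mulf_neq0.
Qed.

Lemma has_valueN x r v : has_value x r v -> has_value x (- r) (- v).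
Proof.
move=> rv; rewrite -mulN1r -[- v]mulN1r; apply: has_valueM => //.
by have := has_value_cst x (-1); rewrite rmorphN rmorph1.
Qed.

Lemma has_valueB x r s v w :
  has_value x r v -> has_value x s w -> has_value x (r - s) (v - w).
Proof. by move=> rv sw; apply/has_valueD/has_valueN. Qed.

Lemma has_value_sum (I : Type) (l : seq I) x (f : I -> F) (g : I -> R) :
    (forall i, has_value x (f i) (g i)) ->
  has_value x (\sum_(i <- l) f i) (\sum_(i <- l) g i).
Proof.
move=> fg; apply: (big_ind2 (has_value x)) => //; first exact: has_value0.
by move=> *; apply: has_valueD.
Qed.

Lemma has_value_prod (I : Type) (l : seq I) x (f : I -> F) (g : I -> R) :
    (forall i, has_value x (f i) (g i)) ->
  has_value x (\prod_(i <- l) f i) (\prod_(i <- l) g i).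
Proof.
move=> fg; apply: (big_ind2 (has_value x)) => //; last by move=> *; apply: has_valueM.
by have := has_value_cst x 1; rewrite rmorph1.
Qed.

Lemma has_value_mmap l x (f : 'I_l -> F) (g : 'I_l -> R) (p : {mpoly R[l]}) :
  (forall i, has_value x (f i) (g i)) -> has_value x (mmap cst f p) p.@[g].
Proof.
move=> fg; apply: has_value_sum => s; apply: has_valueM; first exact: has_value_cst.
apply: has_value_prod => i; elim: (s i) => [|e IHe]; last first.
  by rewrite !exprS; apply: has_valueM.
by have := has_value_cst x 1; rewrite rmorph1.
Qed.

Definition mx_has_value x a b (A : 'M[F]_(a, b)) (B : 'M[R]_(a, b)) :=
  forall i j, has_value x (A i j) (B i j).

Lemma mx_has_value_mul x a b c (A : 'M_(a, b)) B (C : 'M_(b, c)) D :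
  mx_has_value x A B -> mx_has_value x C D -> mx_has_value x (A *m C) (B *m D).
Proof.
move=> AB CD i j; rewrite !mxE; apply: has_value_sum => l.
exact: has_valueM.
Qed.

Lemma mx_has_value_tr x a b (A : 'M_(a, b)) B :
  mx_has_value x A B -> mx_has_value x A^T B^T.
Proof. by move=> AB i j; rewrite !mxE. Qed.

Lemma mx_has_value_cst x a b (B : 'M_(a, b)) : mx_has_value x (map_mx cst B) B.
Proof. by move=> i j; rewrite mxE; apply: has_value_cst. Qed.

(** The product of the denominators serves as [D]. *)
Lemma generic_values (T : finType) (r : T -> F) :
  exists2 D : P, D != 0 & forall x, D.@[x] != 0 ->
    exists s : T -> R, forall i, has_value x (r i) (s i).
Proof.
exists (\prod_i \d_(repr (r i))).
  by apply/prodf_neq0 => i _; apply: denom_ratioP.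
move=> x; rewrite rmorph_prod => /prodf_neq0 nz.
exists (fun i => (\n_(repr (r i))).@[x] / (\d_(repr (r i))).@[x]) => i.
exists \n_(repr (r i)), \d_(repr (r i)); split=> //; first exact: nz.
exact: frac_numden.
Qed.

Lemma frac_vanishing (r : F) (D : P) : D != 0 ->
  (forall x, D.@[x] != 0 -> has_value x r 0) -> r = 0.
Proof.
move=> D0 r0; rewrite [r]frac_numden; set a := \n_ _; set b := \d_ _.
(* The factor [b * D] kills the points at which the value of [r] is not controlled, so the product
   vanishes at every real point. *)
suff : a * (b * D) = 0.
  by move/eqP; rewrite !mulf_eq0 (negbTE D0) (negbTE (denom_ratioP _)) orbF orbF
    => /eqP ->; rewrite tofrac0 mul0r.
apply: mpoly_vanishing => x; rewrite !mevalM.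
have [->|bx] := eqVneq b.@[x] 0; first by rewrite mul0r mulr0.
have [->|Dx] := eqVneq D.@[x] 0; first by rewrite !mulr0.
have /has_value_uniq/(_ (r0 x Dx)) : has_value x r (a.@[x] / b.@[x]).
  by exists a, b; split=> //; apply: frac_numden.
by move/eqP; rewrite mulf_eq0 invr_eq0 (negbTE bx) orbF => /eqP ->; rewrite mul0r.
Qed.

End Values.

(** * Invariant rational functions *)

Lemma omega_map (S T : comNzRingType) (phi : {rmorphism S -> T}) n
    (u v : 'cV[S]_(n + n)) :
  phi (omega u v) = omega (map_mx phi u) (map_mx phi v).
Proof.
by rewrite /omega rmorph_sum; apply: eq_bigr => k _; rewrite rmorphB !rmorphM !mxE.
Qed.

Lemma omegaC (S : comNzRingType) n (u v : 'cV[S]_(n + n)) :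
  omega u v = - omega v u.
Proof. by rewrite /omega -sumrN; apply: eq_bigr => k _; rewrite opprB. Qed.

Lemma omega_alt (S : comNzRingType) n (u : 'cV[S]_(n + n)) : omega u u = 0.
Proof. by rewrite /omega big1 // => k _; rewrite subrr. Qed.

Section Action.
Variables (R : realType) (n m : nat).
Local Notation N := ((n + n) * m)%N.
Local Notation P := (polyfun R n m).
Local Notation F := (ratfun R n m).
Local Notation tofrac := (@FracField.tofrac P).
Local Notation cst := (tofrac \o @mpolyC N R).
Local Notation X := (generic_point R n m).
Local Notation A := (map_mx tofrac X).

Definition point (x : 'I_N -> R) : 'M[R]_(n + n, m) := vec_mx (\row_z x z).

(** The type [S] is left general so as to cover both real points and points with coordinates in
    [F]. *)
Definition coords (S : Type) (B : 'M[S]_(n + n, m)) : 'I_N -> S :=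
  fun z => mxvec B 0 z.

Lemma coordsK (B : 'M[R]_(n + n, m)) : point (coords B) = B.
Proof. by rewrite /point -[RHS]mxvecK; congr vec_mx; apply/rowP=> z; rewrite mxE. Qed.

Lemma pointK x : coords (point x) =1 x.
Proof. by move=> z; rewrite /coords vec_mxK mxE. Qed.

Lemma meval_generic x : map_mx (meval x) X = point x.
Proof. by apply/matrixP=> i j; rewrite !mxE mevalXU. Qed.

Lemma mpoly_meval_inj (p q : P) : (forall x, p.@[x] = q.@[x]) -> p = q.
Proof.
move=> pq; apply/eqP; rewrite -subr_eq0; apply/eqP/mpoly_vanishing=> x.
by rewrite mevalB pq subrr.
Qed.

Lemma poly_act_meval g (p : P) x :
  (poly_act g p).@[x] = p.@[coords (g *m point x)].
Proof.
rewrite comp_mpoly_meval; apply: meval_eq => z; rewrite tnth_mktuple /coords.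
suff -> : g *m point x = map_mx (meval x) (map_mx (@mpolyC N R) g *m X).
  by rewrite -map_mxvec mxE.
rewrite map_mxM meval_generic; congr (_ *m _).
by apply/matrixP=> i j; rewrite !mxE /= mevalC.
Qed.

Lemma poly_actM g : {morph @poly_act R n m g : p q / p * q}.
Proof. exact: rmorphM. Qed.

Lemma poly_actB g : {morph @poly_act R n m g : p q / p - q}.
Proof. exact: rmorphB. Qed.

Lemma poly_act0 g : @poly_act R n m g 0 = 0.
Proof. exact: rmorph0. Qed.

Lemma poly_act1 g : @poly_act R n m g 1 = 1.
Proof. exact: rmorph1. Qed.

(** If p(gx) = 0 for all x, then replacing x by g^-1 x gives p(x) = 0. *)
Lemma poly_act_neq0 g (p : P) : symplectic g -> p != 0 -> poly_act g p != 0.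
Proof.
move=> /symplecticP/symplectic_inv[h [_ gh _]]; apply: contraNneq => gp0.
apply/eqP/mpoly_vanishing => x.
rewrite -(meval0 (coords (h *m point x))) -gp0 poly_act_meval coordsK mulmxA gh.
by rewrite mul1mx; apply: meval_eq => z; rewrite pointK.
Qed.

(** The cross-multiplied equality of two fractions is preserved by the ring morphism [poly_act g],
    which kills no denominator. *)
Lemma rat_act_frac g (a b : P) : symplectic g -> b != 0 ->
  rat_act g (tofrac a / tofrac b : F) = tofrac (poly_act g a) / tofrac (poly_act g b).
Proof.
move=> sg b0; rewrite /rat_act; set f : F := tofrac a / tofrac b.
have /eqP := frac_numden f; rewrite /f eqr_div ?tofrac_eq0 ?denom_ratioP //.
rewrite -!tofracM tofrac_eq => /eqP/(congr1 (poly_act g)); rewrite !poly_actM => eq_ab.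
apply/eqP; rewrite eqr_div ?tofrac_eq0 ?poly_act_neq0 ?denom_ratioP //.
by rewrite -!tofracM tofrac_eq -eq_ab.
Qed.

Lemma rat_act_tofrac g (p : P) :
  symplectic g -> rat_act g (tofrac p : F) = tofrac (poly_act g p).
Proof.
move=> sg; rewrite -[tofrac p in LHS]divr1 -tofrac1 rat_act_frac ?oner_neq0 //.
by rewrite poly_act1 tofrac1 divr1.
Qed.

Lemma rat_actB g (f h : F) :
  symplectic g -> rat_act g (f - h) = rat_act g f - rat_act g h.
Proof.
move=> sg; rewrite [f]frac_numden [h]frac_numden.
set a := \n_(repr f); set b := \d_(repr f); set c := \n_(repr h); set d := \d_(repr h).
have b0 : b != 0 by exact: denom_ratioP.
have d0 : d != 0 by exact: denom_ratioP.
have gb0 : poly_act g b != 0 by exact: poly_act_neq0.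
have gd0 : poly_act g d != 0 by exact: poly_act_neq0.
rewrite !(rat_act_frac _ sg) // -[LHS]/(rat_act g (_ - _)).
have subf (p q r s : P) : q != 0 -> s != 0 ->
    tofrac p / tofrac q - tofrac r / tofrac s
      = tofrac (p * s - r * q) / tofrac (q * s) :> F.
  by move=> q0 s0; rewrite -mulNr addf_div ?tofrac_eq0 // mulNr tofracB !tofracM.
by rewrite !subf // rat_act_frac ?mulf_neq0 // poly_actB !poly_actM.
Qed.

Lemma rat_act_div g (f h : F) :
  symplectic g -> rat_act g (f / h) = rat_act g f / rat_act g h.
Proof.
move=> sg; rewrite [f]frac_numden [h]frac_numden.
set a := \n_(repr f); set b := \d_(repr f); set c := \n_(repr h); set d := \d_(repr h).
have b0 : b != 0 by exact: denom_ratioP.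
have d0 : d != 0 by exact: denom_ratioP.
rewrite !(rat_act_frac _ sg) // !invf_div.
(* If [c] is 0, so is [h], and both sides are 0 by the convention on the inverse of 0. *)
have [->|c0] := eqVneq c 0.
  rewrite poly_act0 tofrac0 invr0 !mulr0.
  by rewrite -tofrac0 rat_act_tofrac // poly_act0.
rewrite !mulf_div -!tofracM rat_act_frac ?mulf_neq0 //.
by rewrite !poly_actM.
Qed.

Lemma Sp_invariant_cst c : Sp_invariant (@constfun R n m c).
Proof.
move=> g sg; rewrite /constfun rat_act_tofrac //; congr tofrac.
exact: comp_mpolyC.
Qed.

Lemma meval_omega x i j :
  (omega (col i X) (col j X)).@[x] = omega (col i (point x)) (col j (point x)).
Proof. by rewrite omega_map !map_col meval_generic. Qed.

Lemma Sp_invariant_a i j : Sp_invariant (a_ R n i j : F).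
Proof.
move=> g sg; rewrite rat_act_tofrac //; congr tofrac; apply: mpoly_meval_inj => x.
rewrite poly_act_meval !meval_omega coordsK.
have colg k : col k (g *m point x) = g *m col k (point x) by rewrite !colE mulmxA.
by rewrite !colg sg.
Qed.

(** This makes the invariants one of the subfields intersected in [generated_subfield]; [asbool]
    supplies the boolean predicate required there. *)
Lemma Sp_invariant_divring : GRing.divring_closed [pred f : F | `[< Sp_invariant f >]].
Proof.
split=> [|f h|f h]; rewrite !inE.
- apply/asboolP; have := Sp_invariant_cst 1.
  by rewrite /constfun -[1%:MP]/(1 : P) tofrac1.
- by move=> /asboolP f_inv /asboolP h_inv; apply/asboolP=> g sg;
    rewrite rat_actB // f_inv // h_inv.
by move=> /asboolP f_inv /asboolP h_inv; apply/asboolP=> g sg;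
  rewrite rat_act_div // f_inv // h_inv.
Qed.

(** The value of [p] at an [F]-valued point of V^m. With [B] of the form g A it extends the action
    on polynomials from real matrices to matrices over [F]. *)
Definition frac_eval (B : 'M[F]_(n + n, m)) (p : P) : F := mmap cst (coords B) p.

Lemma frac_eval_in (E : divringClosed F) B p : (forall c, cst c \in E) ->
  B \is a mxOver E -> frac_eval B p \in E.
Proof.
move=> Ecst /mxOverP EB; apply: rpred_sum => s _; rewrite rpredM //.
apply: rpred_prod => z _; rewrite rpredX //.
by case/mxvec_indexP: z => i j; rewrite /coords mxvecE.
Qed.

Lemma generic_has_value x : mx_has_value x A (point x).
Proof.
move=> i j; rewrite !mxE; have := has_value_tofrac x 'X_(mxvec_index i j).
by rewrite mevalXU.
Qed.

Lemma frac_eval_has_value x B C (p : P) :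
  mx_has_value x B C -> has_value x (frac_eval B p) p.@[coords C].
Proof.
move=> BC; apply: has_value_mmap => z.
case/mxvec_indexP: z => i j; rewrite /coords !mxvecE. exact: BC.
Qed.

Lemma mx_generic_values a b (g : 'M[F]_(a, b)) :
  exists2 D : P, D != 0 & forall x, D.@[x] != 0 ->
    exists g0 : 'M[R]_(a, b), mx_has_value x g g0.
Proof.
have [D D0 DP] := generic_values (fun ij : 'I_a * 'I_b => g ij.1 ij.2).
exists D => // x /DP[s sP]; exists (\matrix_(i, j) s (i, j)) => i j.
by rewrite mxE; apply: (sP (i, j)).
Qed.

(** Both sides of the equation for [g] have values at [x], and values are unique. *)
Lemma symplectic_value x (g : 'M[F]_(n + n)) g0 :
  g^T *m sympJ F n *m g = sympJ F n -> mx_has_value x g g0 ->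
  g0^T *m sympJ R n *m g0 = sympJ R n.
Proof.
move=> gJ gg0; apply/matrixP=> i j.
have Jv : mx_has_value x (sympJ F n) (sympJ R n).
  by rewrite -(map_sympJ cst); apply: mx_has_value_cst.
apply: has_value_uniq (Jv i j); rewrite -gJ.
by apply: mx_has_value_mul => //; apply: mx_has_value_mul => //; apply: mx_has_value_tr.
Qed.

(** At a real point [x] where [g] has a value [g0], the identity becomes invariance of [f] under the
    real symplectic [g0]. Such points suffice by [frac_vanishing]. *)
Lemma Sp_invariant_generic (f : F) (g : 'M[F]_(n + n)) :
    Sp_invariant f -> g^T *m sympJ F n *m g = sympJ F n ->
  frac_eval (g *m A) \n_(repr f) * tofrac \d_(repr f)
    = tofrac \n_(repr f) * frac_eval (g *m A) \d_(repr f).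
Proof.
move=> f_inv gJ; set p := \n_ _; set q := \d_ _; apply/eqP; rewrite -subr_eq0.
have [D D0 DP] := mx_generic_values g; apply/eqP/(frac_vanishing D0) => x /DP[g0 gg0].
have /symplecticP sg := symplectic_value gJ gg0.
have gAv : mx_has_value x (g *m A) (g0 *m point x).
  exact/mx_has_value_mul/generic_has_value.
have -> : 0 = p.@[coords (g0 *m point x)] * q.@[x]
              - p.@[x] * q.@[coords (g0 *m point x)].
  have q0 : q != 0 by exact: denom_ratioP.
  have := f_inv _ sg; rewrite {2}[f]frac_numden => /eqP.
  rewrite /rat_act -/p -/q eqr_div ?tofrac_eq0 //; last first.
    exact: poly_act_neq0.
  rewrite -!tofracM tofrac_eq => /eqP/(congr1 (meval x)).
  by rewrite !mevalM !poly_act_meval => ->; rewrite subrr.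
by apply: has_valueB; apply: has_valueM;
  do ?[exact: has_value_tofrac | exact: frac_eval_has_value].
Qed.

(* Translate the slice by the inverse of g(x), for a real point x where g is
   defined and q does not vanish. *)
Lemma slice_translate (E : divringClosed F) (g : 'M[F]_(n + n)) (q : P) :
    (forall c, cst c \in E) -> q != 0 ->
    g^T *m sympJ F n *m g = sympJ F n -> g *m A \is a mxOver E ->
  exists g' : 'M[F]_(n + n), [/\ g'^T *m sympJ F n *m g' = sympJ F n,
    g' *m A \is a mxOver E & frac_eval (g' *m A) q != 0].
Proof.
move=> Ecst q0 gJ EgA; have [D D0 DP] := mx_generic_values g.
have [x Dqx] : exists x, (D * q).@[x] != 0.
  apply: contrapT => /forallNP Dq0.
  have /eqP : D * q = 0.
    by apply: mpoly_vanishing => x; apply/eqP/negPn/negP/Dq0.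
  by rewrite mulf_eq0 (negbTE D0) (negbTE q0).
move: Dqx; rewrite mevalM mulf_eq0 negb_or => /andP[/DP[g0 gg0] qx].
have [h [hg _ hJ]] := symplectic_inv (symplectic_value gJ gg0).
exists (map_mx cst h *m g); split.
- have hJF : (map_mx cst h)^T *m sympJ F n *m map_mx cst h = sympJ F n.
    by rewrite map_trmx -(map_sympJ cst) -!map_mxM hJ.
  by rewrite trmx_mul !mulmxA -(mulmxA g^T) -(mulmxA g^T) hJF.
- rewrite -mulmxA mxOver_mulmx //.
  by apply/mxOverP=> i j; rewrite mxE; apply: Ecst.
(* The matrix [map_mx cst h *m g] has value 1 at [x], so the fraction takes there the nonzero value
   q(x). *)
have : has_value x (frac_eval (map_mx cst h *m g *m A) q) q.@[x].
  rewrite (meval_eq q (fun z => esym (pointK x z))); apply: frac_eval_has_value.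
  rewrite -[point x]mul1mx -hg; apply: mx_has_value_mul; last exact: generic_has_value.
  by apply: mx_has_value_mul => //; apply: mx_has_value_cst.
move=> qv; apply: contraNneq qx => gq0; move: qv; rewrite gq0.
by move=> /has_value_uniq/(_ (has_value0 x)) ->.
Qed.

(** The minor is a nonzero polynomial: at the point with ones on the diagonal and zeros elsewhere
    the submatrix is the identity. *)
Lemma generic_minor_unit r (f : 'I_r -> 'I_(n + n)) (h : 'I_r -> 'I_m) :
    (forall i j, (f i == h j :> nat) = (i == j)) ->
  mxsub f h A \in unitmx.
Proof.
move=> fh; rewrite unitmxE -map_mxsub det_map_mx unitfE tofrac_eq0.
pose x := coords (\matrix_(i < n + n, j < m) (i == j :> nat)%:R : 'M[R]_(n + n, m)).
apply/eqP => /(congr1 (meval x)).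
rewrite -det_map_mx map_mxsub meval_generic meval0 coordsK.
set B := mxsub _ _ _; have -> : B = 1%:M by apply/matrixP=> i j; rewrite !mxE fh.
by rewrite det1 => /eqP; rewrite oner_eq0.
Qed.

Lemma generic_slice (E : divringClosed F) :
    (forall i j : 'I_m, (i < 2 * n)%N -> (i < j)%N -> a_ R n i j \in E) ->
  exists2 g : 'M[F]_(n + n), g^T *m sympJ F n *m g = sympJ F n
    & g *m A \is a mxOver E.
Proof.
(* Antisymmetry, and 0 on the diagonal, give every Gram entry with at least one index below 2n. *)
move=> Ea; have Egram (i j : 'I_m) : ((i < 2 * n) || (j < 2 * n))%N ->
    (A^T *m sympJ F n *m A) i j \in E.
  have aE k l : (A^T *m sympJ F n *m A) k l = a_ R n k l.
    by rewrite -omega_col -!map_col -omega_map.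
  case: (ltngtP i j) => [ltij|ltji|/val_inj ->] lt2n; rewrite aE.
  - by apply: Ea => //; case/orP: lt2n => //; apply: ltn_trans.
  - rewrite /a_ omegaC rmorphN rpredN; apply: Ea => //.
    by case/orP: lt2n => // /(ltn_trans ltji).
  by rewrite /a_ omega_alt rmorph0 rpred0.
have n2 : (n + n = 2 * n)%N by rewrite mul2n addnn.
case: (leqP m (n + n)) => [lem | /ltnW lem].
  apply: symplectic_slice_small => //.
    have Aunit : mxsub (widen_ord lem) id A \in unitmx by exact: generic_minor_unit.
    apply/eqP; rewrite eqn_leq rank_leq_col -{1}(mxrank_unit Aunit).
    exact/mxrankS/rowsub_sub.
  by apply/mxOverP=> i j; apply: Egram; rewrite -n2 (leq_trans _ lem).
apply: (@symplectic_slice_large _ _ E _ _ (widen_ord lem)).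
  exact: (@generic_minor_unit _ id).
by move=> i j; apply: Egram; rewrite -n2 /= ltn_ord.
Qed.

(** Dividing the identity of [Sp_invariant_generic] by the nonzero q(gA) writes [f] as a quotient of
    polynomials in the entries of gA, which lie in [E]. *)
Lemma Sp_invariant_in (E : divringClosed F) (f : F) :
    (forall c, cst c \in E) ->
    (forall i j : 'I_m, (i < 2 * n)%N -> (i < j)%N -> a_ R n i j \in E) ->
  Sp_invariant f -> f \in E.
Proof.
move=> Ecst Ea f_inv; have [g gJ EgA] := generic_slice Ea.
have q0 : \d_(repr f) != 0 by exact: denom_ratioP.
have {g gJ EgA} [g [gJ EgA qg0]] := slice_translate Ecst q0 gJ EgA.
have /eqP := Sp_invariant_generic f_inv gJ.
rewrite -[_ == _](@eqr_div _ _ _ _ _ qg0) ?tofrac_eq0 //.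
move=> /eqP; rewrite -frac_numden => <-.
by rewrite rpred_div // frac_eval_in.
Qed.

End Action.

(** * Algebraic independence and counting *)

(** Bundles the closure proof so that the [rpred] lemmas apply to [E]. *)
Lemma divringClosed_pack (K : fieldType) (E : {pred K}) :
  GRing.divring_closed E ->
  exists E' : divringClosed K, forall f, (f \in E') = (f \in E).
Proof.
move=> closedE.
pose E' : divringClosed K := HB.pack E (GRing.isDivringClosed.Build K E closedE).
by exists E'.
Qed.

Lemma rmorph_mmap k (R : nzRingType) (S T : comNzRingType) (phi : {rmorphism S -> T})
    (f : R -> S) (h : 'I_k -> S) (p : {mpoly R[k]}) :
  phi (mmap f h p) = mmap (phi \o f) (phi \o h) p.
Proof.
rewrite /mmap rmorph_sum; apply: eq_bigr => s _; rewrite rmorphM; congr (_ * _).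
by rewrite /mmap1 rmorph_prod; apply: eq_bigr => i _; rewrite rmorphXn.
Qed.

Lemma eq_mmap k (R : nzRingType) (S : comNzRingType) (f1 f2 : R -> S)
    (h1 h2 : 'I_k -> S) (p : {mpoly R[k]}) :
  f1 =1 f2 -> h1 =1 h2 -> mmap f1 h1 p = mmap f2 h2 p.
Proof. by move=> f12 h12; apply: eq_bigr => s _; rewrite f12 (mmap1_eq _ h12). Qed.

Lemma mpolyXU_inj (R : realType) k : injective (fun i : 'I_k => 'X_i : {mpoly R[k]}).
Proof.
move=> i j /(congr1 (meval (fun z => (z == i)%:R))); rewrite !mevalXU eqxx.
by case: eqVneq => // _ /eqP; rewrite oner_eq0.
Qed.

Lemma mmap_vars_eq0 (R : realType) k l (z : 'I_k -> 'I_l) (p : {mpoly R[k]}) :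
  injective z -> mmap (@mpolyC l R) (fun i => 'X_(z i)) p = 0 -> p = 0.
Proof.
move=> z_inj p0; apply: mpoly_vanishing => v.
(* [w] extends the point [v] along [z], with the default 0 off the image. *)
pose w t := if [pick i | z i == t] is Some i then v i else 0.
have := congr1 (meval w) p0; rewrite meval0 => <-.
rewrite (rmorph_mmap (meval w)) /meval; apply: eq_bigr => s _ /=.
rewrite mevalC; congr (_ * _); apply: mmap1_eq => i /=; rewrite mevalXU /w.
by case: pickP => [j /eqP/z_inj -> //|/(_ i)]; rewrite eqxx.
Qed.

Lemma mxvec_index_inj a b (i i' : 'I_a) (j j' : 'I_b) :
  mxvec_index i j = mxvec_index i' j' -> i = i' /\ j = j'.
Proof. by move=> /cast_ord_inj/enum_rank_inj[-> ->]. Qed.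

Lemma congr_inv (K : fieldType) d (P M M' : 'M[K]_d) :
  P \in unitmx -> P *m M *m P^T = M' -> M = invmx P *m M' *m (invmx P)^T.
Proof.
by move=> Punit <-; rewrite trmx_inv !mulmxA mulVmx // mul1mx mulmxK ?unitmx_tr.
Qed.

(** * Realizing a generic alternating matrix by vectors *)

Section GenericGram.
Variables (R : realType) (n m : nat).
Local Notation M := ((n + n) + m)%N.
Local Notation Q := {mpoly R[M * M]}.
Local Notation L := {fraction Q}.
Local Notation tofrac := (@FracField.tofrac Q).

(** The variables form a square grid of size 2n + m, so that a leading 2n by 2n block exists even
    for m < 2n; the m vectors correspond to the first m indices. *)
Definition gram_coord (i j : 'I_m) : 'I_(M * M) :=
  mxvec_index (widen_ord (leq_addl (n + n) m) i) (widen_ord (leq_addl (n + n) m) j).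

Definition upper_generic : 'M[Q]_M :=
  \matrix_(i, j) if (i < j)%N then 'X_(mxvec_index i j) else 0.

Definition generic_gram : 'M[Q]_M := upper_generic - upper_generic^T.

(** The determinant is a nonzero polynomial, since the variables can be specialized so that the
    leading block becomes J. *)
Lemma generic_gram_unit : map_mx tofrac (ulsubmx generic_gram) \in unitmx.
Proof.
rewrite unitmxE det_map_mx unitfE tofrac_eq0.
pose x := fun t : 'I_(M * M) => mxvec (block_mx (sympJ R n) 0 0 (0 : 'M_m)) 0 t.
apply/eqP => /(congr1 (meval x)); rewrite -det_map_mx meval0.
suff -> : map_mx (meval x) (ulsubmx generic_gram) = sympJ R n.
  by move/eqP; rewrite -[_ == 0]negbK -unitfE -unitmxE sympJ_unit.
have xE i j : x (mxvec_index (lshift m i) (lshift m j)) = sympJ R n i j.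
  by rewrite /x mxvecE block_mxEul.
have Jtr i j : sympJ R n i j = - sympJ R n j i.
  have := congr1 (fun B : 'M_(n + n) => B j i) (trmx_sympJ R n).
  by rewrite mxE => ->; rewrite mxE.
have evalE (i j : 'I_(n + n)) : map_mx (meval x) (ulsubmx generic_gram) i j
    = (if (i < j)%N then 'X_(mxvec_index (lshift m i) (lshift m j)) else 0).@[x]
      - (if (j < i)%N then 'X_(mxvec_index (lshift m j) (lshift m i)) else 0).@[x].
  by rewrite !mxE /= mevalB.
apply/matrixP=> i j; rewrite evalE.
case: (ltngtP i j) => [_|_|/val_inj ->]; rewrite ?mevalXU ?meval0 ?xE.
- by rewrite subr0.
- by rewrite sub0r -Jtr.
rewrite subrr; have := omega_alt (delta_mx j 0 : 'cV[R]_(n + n)).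
by rewrite omegaE trmx_delta -rowE -colE mxE mxE => ->.
Qed.

(** Write the leading block of the generic matrix G as Y J Y^T and solve Y J B = (top 2n rows of G).
    The first 2n columns of B form Y^T, so column i pairs with column j to the entry (i, j) of G. *)
Lemma generic_gram_realized :
  exists B : 'M[L]_(n + n, m), forall i j : 'I_m, (i < 2 * n)%N -> (i < j)%N ->
    omega (col i B) (col j B) = tofrac 'X_(gram_coord i j).
Proof.
(* The whole field [L] serves as the subfield. *)
have [E inE] : exists E : divringClosed L, forall f, (f \in E) = (f \in predT).
  exact: divringClosed_pack.
pose G := map_mx tofrac generic_gram; pose J := sympJ L n.
have altG0 : alternating (ulsubmx G).
  have -> : ulsubmx G = map_mx tofrac (ulsubmx upper_generic)
                        - (map_mx tofrac (ulsubmx upper_generic))^T.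
    by apply/matrixP=> i j; rewrite !mxE tofracB.
  exact: alternating_subtr.
have G0unit : ulsubmx G \in unitmx.
  by rewrite /G -map_ulsubmx generic_gram_unit.
have [|P _ PE] := standardize_gram (E := E) altG0 G0unit.
  by apply/mxOverP=> i j; rewrite inE.
have /andP[Punit _] : (P \in unitmx) && (ulsubmx G *m P^T \in unitmx).
  by rewrite -unitmx_mul mulmxA PE sympJ_unit.
pose Y := invmx P.
have YJ : Y *m J \in unitmx by rewrite unitmx_mul unitmx_inv Punit sympJ_unit.
have G0E : ulsubmx G = Y *m J *m Y^T.
  exact: congr_inv Punit PE.
pose B := invmx (Y *m J) *m usubmx G.
have BlE : lsubmx B = Y^T.
  have -> : lsubmx B = invmx (Y *m J) *m ulsubmx G.
    by apply/matrixP=> i j; rewrite !mxE; apply: eq_bigr => k _; rewrite !mxE.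
  by rewrite G0E mulKmx.
pose w := widen_ord (leq_addl (n + n) m).
exists (colsub w B) => i j lt2n ltij.
have lti : (i < n + n)%N by rewrite addnn -mul2n.
have -> : col i (colsub w B) = col (Ordinal lti) Y^T.
  rewrite -BlE; apply/colP=> k; rewrite !mxE; apply: eq_bigr => l _.
  by congr (_ * usubmx G _ _); apply: val_inj.
have -> : col j (colsub w B) = col (w j) B by apply/colP=> k; rewrite !mxE.
rewrite omega_col trmxK mulKVmx // !mxE /= ltij ltnNge ltnW // subr0.
by congr (tofrac 'X_(mxvec_index _ _)); apply: val_inj.
Qed.

End GenericGram.

(** Index i has m - (i + 1) partners; adding back 1 + ... + k avoids truncated subtraction. *)
Lemma sum_pairs m k : (k <= m)%N ->
  (\sum_(i < k) (m - i.+1) + 'C(k.+1, 2) = k * m)%N.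
Proof.
elim: k => [|k IHk] lekm; first by rewrite big_ord0.
by rewrite big_ord_recr /= binS bin1 addnACA IHk 1?ltnW // subnK // mulSn addnC.
Qed.

Lemma card_abar_index m n :
  #|[set ij : 'I_m * 'I_m | (ij.1 < 2 * n)%N && (ij.1 < ij.2)%N]| = d_ m n.
Proof.
rewrite cardsE -sum1_card /=.
rewrite -(pair_big_dep (fun i : 'I_m => i < 2 * n)%N (fun i j : 'I_m => i < j)%N
  (fun _ _ => 1%N)) /=.
have inner (i : 'I_m) : (\sum_(j < m | (i < j)%N) 1 = m - i.+1)%N.
  by rewrite -[RHS]muln1 -sum_nat_const_nat (@big_nat_widenl _ _ _ i.+1 0) // big_mkord.
rewrite (eq_bigr _ (fun i _ => inner i)).
rewrite /d_; case: leqP => [le2nm|/ltnW lem2n].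
  rewrite -(big_ord_widen m (fun i => m - i.+1)%N le2nm).
  have <- : ('C((2 * n).+1, 2) = n * (2 * n + 1))%N.
    by rewrite bin2 /= mulnC mul2n -doubleMl doubleK addn1.
  by rewrite -(sum_pairs le2nm) addnK.
rewrite (eq_bigl xpredT) => [|i]; last by rewrite (leq_trans (ltn_ord i)).
(* Reversing the order turns m - (i + 1) into i, and these sum to the binomial coefficient. *)
rewrite (reindex_inj rev_ord_inj) -bin2_sum big_mkord; apply: eq_bigr => i _ /=.
by rewrite -subSn // subSS subKn // ltnW.
Qed.

Theorem mainTheorem2 (R : realType) (n m : nat) (n_ge1 : (1 <= n)%N) (m_ge1 : (1 <= m)%N) :
  [/\ forall f : ratfun R n m,
        Sp_invariant f <->
        generated_subfield (@constfun R n m) (fun a => a \in abar R n m) f,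
      has_trdeg (@constfun R n m) (@Sp_invariant R n m) (d_ m n),
      #|` abar R n m| = d_ m n
    & algebraically_independent (@constfun R n m) (abar R n m)].
Proof.
have abarP b : b \in abar R n m ->
    exists ij : 'I_m * 'I_m,
      [/\ (ij.1 < 2 * n)%N, (ij.1 < ij.2)%N & b = a_ R n ij.1 ij.2].
  case/imfsetP=> /= ij; rewrite inE => /andP[lt2n ltij] ->.
  by exists ij.
have a_abar (i j : 'I_m) : (i < 2 * n)%N -> (i < j)%N -> a_ R n i j \in abar R n m.
  by move=> lt2n ltij; apply/imfsetP; exists (i, j); rewrite //= inE /= lt2n.
have invariantE f : Sp_invariant f <->
    generated_subfield (@constfun R n m) (fun a => a \in abar R n m) f.
  split=> [f_inv E closedE Ecst Ea | genf].
    have [E' EE'] := divringClosed_pack closedE.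
    rewrite -EE'; apply: Sp_invariant_in => // [c|i j lt2n ltij]; rewrite EE'.
      exact: Ecst.
    exact/Ea/a_abar.
  apply/asboolP/(genf _ (Sp_invariant_divring R n m)) => [c|b].
    exact/asboolP/Sp_invariant_cst.
  by move=> /abarP[ij [_ _ ->]]; apply/asboolP/Sp_invariant_a.
have [B BE] := generic_gram_realized R n m.
(* Substitution of the vectors of [B] for the generic ones; it sends the polynomial of [a_ R n i j]
   to the variable c_ij. *)
pose phi := mmap (@FracField.tofrac _ \o @mpolyC _ R) (coords B).
have BaE (i j : 'I_m) : (i < 2 * n)%N -> (i < j)%N ->
    phi (omega (col i (generic_point R n m)) (col j (generic_point R n m)))
    = FracField.tofrac 'X_(gram_coord n i j).
  move=> lt2n ltij; rewrite /phi -BE // omega_map; congr omega; apply/colP=> k.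
    by rewrite !mxE /= mmapX mmap1U /coords mxvecE.
  by rewrite !mxE /= mmapX mmap1U /coords mxvecE.
have gram_coord_inj (i j i' j' : 'I_m) : gram_coord n i j = gram_coord n i' j' ->
    i = i' /\ j = j'.
  by move=> /mxvec_index_inj[/(congr1 val) Ei /(congr1 val) Ej]; split; apply: val_inj.
(* Distinct index pairs give distinct functions, because [phi] sends them to distinct variables. *)
have card_abar : #|` abar R n m| = d_ m n.
  rewrite card_in_imfset /= => [|[i j] [i' j']]; last first.
    rewrite !inE /= => /andP[lt2n ltij] /andP[lt2n' ltij'] /eqP.
    rewrite tofrac_eq => /eqP /(congr1 phi).
    rewrite !BaE // => /eqP; rewrite tofrac_eq => /eqP/mpolyXU_inj.
    by move=> /gram_coord_inj[-> ->].
  by rewrite -card_abar_index cardE.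
have indep : algebraically_independent (@constfun R n m) (abar R n m).
  move=> p p0; pose b := enum_fset (abar R n m).
  have bP (k : 'I_(#|` abar R n m|)) : exists ij : 'I_m * 'I_m,
      [/\ (ij.1 < 2 * n)%N, (ij.1 < ij.2)%N & b`_k = a_ R n ij.1 ij.2].
    by apply/abarP/mem_nth.
  have /fin_all_exists[ij ijP] := bP.
  pose c k := omega (col (ij k).1 (generic_point R n m))
                    (col (ij k).2 (generic_point R n m)).
  pose z k := gram_coord n (ij k).1 (ij k).2.
  have z_inj : injective z.
    move=> k l /gram_coord_inj[E1 E2]; apply/val_inj/eqP.
    rewrite -(nth_uniq 0 (ltn_ord k) (ltn_ord l) (fset_uniq _)) -/b.
    by have [_ _ ->] := ijP k; have [_ _ ->] := ijP l; rewrite E1 E2.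
  (* [phi] is defined on polynomials only, so the relation is first lifted from the fraction field
     to the polynomials [c k]. Applying [phi] then gives a relation between distinct variables. *)
  have /eqP : FracField.tofrac (mmap (@mpolyC _ R) c p) = 0 :> ratfun R n m.
    rewrite rmorph_mmap -[RHS]p0; apply: eq_mmap => // k /=.
    by have [_ _ ->] := ijP k.
  rewrite tofrac_eq0 => /eqP/(congr1 phi).
  rewrite /phi rmorph_mmap mmap0 => p1; apply: (mmap_vars_eq0 z_inj).
  apply/eqP; rewrite -tofrac_eq0 -p1 rmorph_mmap; apply/eqP.
  apply: eq_mmap => [t|k] /=; first by rewrite mmapC.
  by have [lt2n ltij _] := ijP k; rewrite -/phi BaE.
split=> //; exists (abar R n m); split=> //; split=> // [b|f /invariantE genf].
  by move=> /abarP[ij [_ _ ->]]; apply: Sp_invariant_a.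
(* An invariant already lies in the generated field, so it is the root of a linear polynomial over
   it. *)
exists ('X - f%:P); split; last 1 first.
- by rewrite root_XsubC.
- by rewrite polyXsubC_eq0.
move=> i E closedE Ecst Ea; have [E' EE'] := divringClosed_pack closedE.
rewrite -EE' coefB coefX coefC rpredB ?rpred_nat //.
by case: eqP => _; rewrite ?rpred0 // EE'; apply: genf.
Qed.
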